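(* Let $\mathbb{K}$ be an infinite field and let $f_1,\dots,f_m:\mathbb{K}^{n_1}\times\cdots\times\mathbb{K}^{n_d}\to\mathbb{K}$ be polynomial functions of degree at most $1$ in each block of variables (i.e. multi-affine). Let $c_1,\dots,c_m\in\mathbb{K}$ and let $\mathsf{v}\in\mathbb{K}^{n_1}\times\cdots\times\mathbb{K}^{n_d}$ satisfy $(f_1(\mathsf{v}),\dots,f_m(\mathsf{v}))=(c_1,\dots,c_m)$. Put $Z\coloneqq\{\mathsf{w}\in\mathbb{K}^{n_1}\times\cdots\times\mathbb{K}^{n_d}: (f_1(\mathsf{w}),\dots,f_m(\mathsf{w}))=(c_1,\dots,c_m)\}$. Then there exists a subset $W\subseteq Z$ such that (a) $\mathsf{v}\in\overline{W}$; (b) $\overline{W}$ is irreducible; (c) $\operatorname{codim}\overline{W}\le 2^d m$ (codimension in $\overline{\mathbb{K}}^{n_1+\cdots+n_d}$).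
   Context: A function $f:\mathbb{K}^{n_1}\times\cdots\times\mathbb{K}^{n_d}\to\mathbb{K}$ is multi-affine (written $\operatorname{mdeg} f\le(1,\dots,1)$) if it is a polynomial function such that, for every $j\in[d]$ and every fixed choice of the other arguments $\mathsf{v}_s\in\mathbb{K}^{n_s}$ ($s\ne j$), the map $x_j\mapsto f(\mathsf{v}_1,\dots,x_j,\dots,\mathsf{v}_d)$ is a polynomial of degree at most $1$ on $\mathbb{K}^{n_j}$. For an infinite field $\mathbb{K}$ and a subset $S\subseteq\mathbb{K}^n$, $\overline{S}\subseteq\overline{\mathbb{K}}^n$ denotes the set of common zeros in $\overline{\mathbb{K}}^n$ of all polynomials in $\mathbb{K}[x_1,\dots,x_n]$ that vanish on $S$; codimension is $n-\dim$, computed for Zariski closed subsets of $\overline{\mathbb{K}}^n$. *)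

(* Defs.v *)
From mathcomp Require Import all_boot all_order all_algebra.
From mathcomp Require Import mpoly.
Set Implicit Arguments.
Unset Strict Implicit.
Unset Printing Implicit Defensive.
Import GRing.Theory.
Local Open Scope ring_scope.

(* World: plain MathComp + multinomials.
   A point of K^{n_1} x ... x K^{n_d} is a flat function 'I_N -> K with
   N = \sum_(j < d) n j; coordinate i of block j is x (tagnat.Rank j i). *)

Definition totdim (d : nat) (n : 'I_d -> nat) : nat := (\sum_(j < d) n j)%N.

Definition bidx (d : nat) (n : 'I_d -> nat) (j : 'I_d) (i : 'I_(n j))
  : 'I_(totdim n) := @tagnat.Rank d n j i.

Definition is_polyfun (K : fieldType) (N : nat) (f : ('I_N -> K) -> K) : Prop :=
  exists p : {mpoly K[N]}, forall x, f x = p.@[x].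

Definition multi_affine (K : fieldType) (d : nat) (n : 'I_d -> nat)
  (f : ('I_(totdim n) -> K) -> K) : Prop :=
  is_polyfun f /\
  forall (j : 'I_d) (x : 'I_(totdim n) -> K),
    exists (a : 'I_(n j) -> K) (b : K),
      forall y : 'I_(totdim n) -> K,
        (forall (j' : 'I_d) (i : 'I_(n j')), j' != j ->
            y (@bidx d n j' i) = x (@bidx d n j' i)) ->
        f y = b + \sum_(i < n j) a i * y (@bidx d n j i).

Definition is_alg_closure (K : fieldType) (L : closedFieldType)
  (iota : {rmorphism K -> L}) : Prop :=
  forall z : L, exists p : {poly K}, p != 0 /\ root (map_poly iota p) z.

Definition zcl (K : fieldType) (L : closedFieldType) (iota : {rmorphism K -> L})
  (N : nat) (S : ('I_N -> K) -> Prop) : ('I_N -> L) -> Prop :=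
  fun z => forall p : {mpoly K[N]},
    (forall x, S x -> p.@[x] = 0) -> (map_mpoly iota p).@[z] = 0.

Definition zclosed (L : closedFieldType) (N : nat) (V : ('I_N -> L) -> Prop)
  : Prop :=
  exists P : {mpoly L[N]} -> Prop,
    forall z, V z <-> (forall p, P p -> p.@[z] = 0).

Definition psubset (T : Type) (A B : T -> Prop) : Prop := forall z, A z -> B z.

Definition zirreducible (L : closedFieldType) (N : nat)
  (V : ('I_N -> L) -> Prop) : Prop :=
  zclosed V /\ (exists z, V z) /\
  forall A B : ('I_N -> L) -> Prop, zclosed A -> zclosed B ->
    (forall z, V z -> A z \/ B z) -> psubset V A \/ psubset V B.

(* dim V >= r : there is a chain Z_0 < Z_1 < ... < Z_r of irreducible closed
   subsets of V (Krull dimension of V with the Zariski topology) *)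
Definition zdim_ge (L : closedFieldType) (N : nat) (V : ('I_N -> L) -> Prop)
  (r : nat) : Prop :=
  exists Zs : nat -> ('I_N -> L) -> Prop,
    (forall i, (i <= r)%N -> zirreducible (Zs i) /\ psubset (Zs i) V) /\
    (forall i, (i < r)%N ->
       psubset (Zs i) (Zs i.+1) /\ ~ psubset (Zs i.+1) (Zs i)).

(* codim V <= k, i.e. N - dim V <= k, i.e. dim V >= r for some r with N <= r+k *)
Definition zcodim_le (L : closedFieldType) (N : nat) (V : ('I_N -> L) -> Prop)
  (k : nat) : Prop :=
  exists r : nat, zdim_ge V r /\ (N <= r + k)%N.

(* Main.v *)
Require Import Defs.
From mathcomp Require Import all_boot all_order all_algebra.
From mathcomp Require Import mpoly.
From mathcomp Require Import ring zify.
From Stdlib Require Import Classical FunctionalExtensionality.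
Set Implicit Arguments.
Unset Strict Implicit.
Unset Printing Implicit Defensive.
Import GRing.Theory.
Local Open Scope ring_scope.

(* The solutions are parametrized block by block.  Once the blocks [< k] are
   expressed as regular functions of free parameters, the equations are
   affine in block [k], with a slope matrix regular in the earlier blocks.
   On the open set where a fixed maximal minor of that matrix is invertible,
   the solutions of the linear system through [v] are parametrized by the
   coordinates outside the minor, so each block costs at most [m] free
   coordinates.  The image [W] of a basic open subset of [K^N] under the
   final regular map has a prime vanishing ideal (as [K] is infinite), so an
   irreducible closure; [v] is in it, and fixing the [N - d m] free
   coordinates one at a time yields a chain of that length. *)

Section Lines.
Variable K : fieldType.
Hypothesis K_infinite : forall s : seq K, exists x : K, x \notin s.

Lemma exists_uniq_notin (s : seq K) k :
  exists l : seq K, [/\ uniq l, size l = k & all [predC s] l].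
Proof.
elim: k => [|k [l [ul sl al]]]; first by exists [::].
have [x] := K_infinite (l ++ s); rewrite mem_cat negb_or => /andP[xl xs].
by exists (x :: l); rewrite /= xl ul sl xs al.
Qed.

Lemma exists_nonroot_notin (Q : {poly K}) (s : seq K) :
  Q != 0 -> exists2 t, t \notin s & ~~ root Q t.
Proof.
move=> Q0; have [l [ul sl al]] := exists_uniq_notin s (size Q).
have /allPn[t tl nQt] : ~~ all (root Q) l.
  by apply/negP => /(max_poly_roots Q0)/(_ ul); rewrite sl ltnn.
by exists t => //; exact: (allP al).
Qed.

Variable N : nat.
Implicit Types (x y a : 'I_N -> K) (p q : {mpoly K[N]}).

Definition line x1 x2 (t : K) : 'I_N -> K := fun j => x1 j + t * (x2 j - x1 j).

Lemma line0 x1 x2 : line x1 x2 0 =1 x1.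
Proof. by move=> j; rewrite /line mul0r addr0. Qed.

Lemma line1 x1 x2 : line x1 x2 1 =1 x2.
Proof. by move=> j; rewrite /line mul1r addrC subrK. Qed.

Lemma meval_line p x1 x2 :
  exists Q : {poly K}, forall t, Q.[t] = p.@[line x1 x2 t].
Proof.
exists (mmap polyC (fun j => (x1 j)%:P + (x2 j - x1 j)%:P * 'X) p) => t.
rewrite /mmap mevalE horner_sum; apply: eq_bigr => mu _.
rewrite hornerM hornerC /mmap1 horner_prod; congr (_ * _).
apply: eq_bigr => i _; rewrite horner_exp; congr (_ ^+ _).
by rewrite hornerD hornerC hornerM hornerC hornerX /line mulrC.
Qed.

Lemma line_nonvanishing p x1 x2 (s : seq K) :
  p.@[x1] != 0 -> exists2 t, t \notin s & p.@[line x1 x2 t] != 0.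
Proof.
have [Q HQ] := meval_line p x1 x2; move=> px1.
have Q0 : Q != 0.
  by apply: contraNneq px1 => Q0; rewrite -(meval_eq _ (line0 x1 x2)) -HQ Q0 horner0.
by have [t ts] := exists_nonroot_notin s Q0; exists t; rewrite // -HQ.
Qed.

Definition slice (T : pred 'I_N) a x : Prop := forall j, T j -> x j = a j.

Lemma slice_line T a x1 x2 t :
  slice T a x1 -> slice T a x2 -> slice T a (line x1 x2 t).
Proof. by move=> s1 s2 j Tj; rewrite /line s1 // s2 // subrr mulr0 addr0. Qed.

Definition vanishing_prime (S : ('I_N -> K) -> Prop) := forall p q,
  (forall x, S x -> p.@[x] * q.@[x] = 0) ->
  (forall x, S x -> p.@[x] = 0) \/ (forall x, S x -> q.@[x] = 0).

(* Two polynomials nonzero at two points of the slice are simultaneously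
   nonzero somewhere on the line through them. *)
Lemma vanishing_prime_slice T a : vanishing_prime (slice T a).
Proof.
move=> p q pq0.
case: (classic (forall x, slice T a x -> p.@[x] = 0)) => [pS|]; first by left.
move=> /not_all_ex_not[x1 nH]; have [s1 px1] := imply_to_and _ _ nH.
right => x2 s2.
apply: NNPP => qx2.
have [Qp HQp] := meval_line p x1 x2; have [Qq HQq] := meval_line q x1 x2.
have Qp0 : Qp != 0.
  by apply: contra_not_neq px1 => Q0; rewrite -(meval_eq _ (line0 x1 x2)) -HQp Q0 horner0.
have Qq0 : Qq != 0.
  by apply: contra_not_neq qx2 => Q0; rewrite -(meval_eq _ (line1 x1 x2)) -HQq Q0 horner0.
have [t _] := exists_nonroot_notin [::] (mulf_neq0 Qp0 Qq0).
by rewrite /root hornerM HQp HQq pq0 ?eqxx //; exact: slice_line.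
Qed.

End Lines.

Section RegularFunctions.
Variables (K : fieldType) (N : nat).
Implicit Types (g A : {mpoly K[N]}) (F G : ('I_N -> K) -> K).

(* [F] is regular on the basic open set [g != 0]: [F = A / g ^+ e] there. *)
Definition regular g F := exists A (e : nat),
  forall x, g.@[x] != 0 -> g.@[x] ^+ e * F x = A.@[x].

Definition regular_map g (Phi : ('I_N -> K) -> 'I_N -> K) :=
  forall j, regular g (fun x => Phi x j).

Definition regular_mx g p q (M : ('I_N -> K) -> 'M[K]_(p, q)) :=
  forall i j, regular g (fun x => M x i j).

Lemma regular_ext g F G :
  regular g F -> (forall x, g.@[x] != 0 -> F x = G x) -> regular g G.
Proof. by move=> [A [e H]] FG; exists A, e => x gx; rewrite -FG // H. Qed.

Lemma regular_meval g p : regular g (fun x => p.@[x]).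
Proof. by exists p, 0%N => x _; rewrite expr0 mul1r. Qed.

Lemma regular_cst g a : regular g (fun _ => a).
Proof.
by apply: regular_ext (regular_meval g a%:MP) _ => x _; rewrite mevalC.
Qed.

Lemma regular_coord g j : regular g (fun x => x j).
Proof.
by apply: regular_ext (regular_meval g 'X_j) _ => x _; rewrite mevalXU.
Qed.

Lemma regular_id g : regular_map g (fun x => x).
Proof. exact: regular_coord. Qed.

Lemma regularD g F G : regular g F -> regular g G -> regular g (fun x => F x + G x).
Proof.
move=> [A1 [e1 H1]] [A2 [e2 H2]].
exists (g ^+ e2 * A1 + g ^+ e1 * A2), (e1 + e2)%N => x gx.
by rewrite mevalD !mevalM !rmorphXn /= -H1 // -H2 // exprD; ring.
Qed.

Lemma regularN g F : regular g F -> regular g (fun x => - F x).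
Proof. by move=> [A [e H]]; exists (- A), e => x gx; rewrite mevalN -H // mulrN. Qed.

Lemma regularB g F G : regular g F -> regular g G -> regular g (fun x => F x - G x).
Proof. by move=> rF rG; apply: regularD rF (regularN rG). Qed.

Lemma regularM g F G : regular g F -> regular g G -> regular g (fun x => F x * G x).
Proof.
move=> [A1 [e1 H1]] [A2 [e2 H2]]; exists (A1 * A2), (e1 + e2)%N => x gx.
by rewrite mevalM -H1 // -H2 // exprD; ring.
Qed.

Lemma regular_sum g (I : Type) (r : seq I) (P : pred I) (Fs : I -> ('I_N -> K) -> K) :
  (forall i, regular g (Fs i)) -> regular g (fun x => \sum_(i <- r | P i) Fs i x).
Proof.
move=> H; elim: r => [|i r IH].
  by apply: regular_ext (regular_cst g 0) _ => x _; rewrite big_nil.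
case Pi: (P i); [apply: regular_ext (regularD (H i) IH) _ | apply: regular_ext IH _];
  by move=> x _; rewrite big_cons Pi.
Qed.

Lemma regular_prod g (I : Type) (r : seq I) (P : pred I) (Fs : I -> ('I_N -> K) -> K) :
  (forall i, regular g (Fs i)) -> regular g (fun x => \prod_(i <- r | P i) Fs i x).
Proof.
move=> H; elim: r => [|i r IH].
  by apply: regular_ext (regular_cst g 1) _ => x _; rewrite big_nil.
case Pi: (P i); [apply: regular_ext (regularM (H i) IH) _ | apply: regular_ext IH _];
  by move=> x _; rewrite big_cons Pi.
Qed.

Lemma regularX g F k : regular g F -> regular g (fun x => F x ^+ k).
Proof.
move=> rF; elim: k => [|k IH].
  by apply: regular_ext (regular_cst g 1) _ => x _; rewrite expr0.
by apply: regular_ext (regularM rF IH) _ => x _; rewrite exprS.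
Qed.

Lemma regular_mulr g h F : regular g F -> regular (g * h) F.
Proof.
move=> [A [e H]]; exists (h ^+ e * A), e => x.
rewrite mevalM mulf_eq0 negb_or => /andP[gx _].
by rewrite mevalM rmorphXn /= -H // exprMn; ring.
Qed.

Lemma regularV g F A e : (forall x, g.@[x] != 0 -> g.@[x] ^+ e * F x = A.@[x]) ->
  regular (g * A) (fun x => (F x)^-1).
Proof.
move=> H; exists (g ^+ e.+1), 1%N => x.
rewrite mevalM mulf_eq0 negb_or => /andP[gx Ax].
have Fx : F x != 0 by apply: contraNneq Ax => F0; rewrite -H // F0 mulr0.
by rewrite expr1 rmorphXn /= -H // exprS; field.
Qed.

Lemma regular_comp g (Psi : ('I_N -> K) -> 'I_N -> K) p :
  regular_map g Psi -> regular g (fun x => p.@[Psi x]).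
Proof.
move=> rPsi; apply: regular_ext (_ : regular g (fun x =>
   \sum_(mu <- msupp p) p@_mu * \prod_i Psi x i ^+ mu i)) _.
  apply: regular_sum => mu; apply: regularM; first exact: regular_cst.
  by apply: regular_prod => i; apply: regularX.
by move=> x _; rewrite mevalE.
Qed.

Lemma regular1_mpoly F : regular 1 F -> exists A, forall x, F x = A.@[x].
Proof.
move=> [A [e H]]; exists A => x.
by rewrite -H ?meval1 ?expr1n ?mul1r ?oner_neq0.
Qed.

Lemma regular_mx_ext g p q (M M' : ('I_N -> K) -> 'M[K]_(p, q)) :
  regular_mx g M -> (forall x, g.@[x] != 0 -> M x = M' x) -> regular_mx g M'.
Proof. by move=> rM e i j; apply: regular_ext (rM i j) _ => x gx; rewrite e. Qed.

Lemma regular_mx_cst g p q (B : 'M[K]_(p, q)) : regular_mx g (fun _ => B).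
Proof. by move=> i j; exact: regular_cst. Qed.

Lemma regular_mxB g p q (M M' : ('I_N -> K) -> 'M[K]_(p, q)) :
  regular_mx g M -> regular_mx g M' -> regular_mx g (fun x => M x - M' x).
Proof.
move=> rM rM' i j.
by apply: regular_ext (regularB (rM i j) (rM' i j)) _ => x _; rewrite !mxE.
Qed.

Lemma regular_mulmx g p q s (M : ('I_N -> K) -> 'M[K]_(p, q))
    (M' : ('I_N -> K) -> 'M[K]_(q, s)) :
  regular_mx g M -> regular_mx g M' -> regular_mx g (fun x => M x *m M' x).
Proof.
move=> rM rM' i j.
apply: regular_ext (_ : regular g (fun x => \sum_l M x i l * M' x l j)) _.
  by apply: regular_sum => l; apply: regularM.
by move=> x _; rewrite mxE.
Qed.

Lemma regular_scalemx g p q (a : ('I_N -> K) -> K) (M : ('I_N -> K) -> 'M[K]_(p, q)) :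
  regular g a -> regular_mx g M -> regular_mx g (fun x => a x *: M x).
Proof.
by move=> ra rM i j; apply: regular_ext (regularM ra (rM i j)) _ => x _; rewrite mxE.
Qed.

Lemma regular_mx_mulr g h p q (M : ('I_N -> K) -> 'M[K]_(p, q)) :
  regular_mx g M -> regular_mx (g * h) M.
Proof. by move=> rM i j; apply: regular_mulr. Qed.

Lemma regular_det g r (M : ('I_N -> K) -> 'M[K]_r) :
  regular_mx g M -> regular g (fun x => \det (M x)).
Proof.
move=> rM; apply: regular_sum => s; apply: regularM; first exact: regular_cst.
by apply: regular_prod.
Qed.

Lemma regular_adj g r (M : ('I_N -> K) -> 'M[K]_r) :
  regular_mx g M -> regular_mx g (fun x => \adj (M x)).
Proof.
move=> rM i j; apply: regular_ext
  (_ : regular g (fun x => (-1) ^+ (j + i) * \det (row' j (col' i (M x))))) _.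
  apply: regularM; first exact: regular_cst.
  by apply: regular_det => a b; apply: regular_ext (rM _ _) _ => x _; rewrite !mxE.
by move=> x _; rewrite mxE.
Qed.

Lemma regular_invmx g A e r (M : ('I_N -> K) -> 'M[K]_r) :
  regular_mx g M -> (forall x, g.@[x] != 0 -> g.@[x] ^+ e * \det (M x) = A.@[x]) ->
  regular_mx (g * A) (fun x => invmx (M x)).
Proof.
move=> rM detM; apply: regular_mx_ext
  (regular_scalemx (regularV detM) (regular_mx_mulr A (regular_adj rM))) _.
move=> x; rewrite mevalM mulf_eq0 negb_or => /andP[gx Ax].
have Mx : \det (M x) != 0 by apply: contraNneq Ax => D0; rewrite -detM // D0 mulr0.
by rewrite /invmx unitmxE unitfE Mx.
Qed.

End RegularFunctions.

Section ParametrizedImage.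
Variable K : fieldType.
Hypothesis K_infinite : forall s : seq K, exists x : K, x \notin s.
Variable N : nat.
Implicit Types (g : {mpoly K[N]}) (Phi : ('I_N -> K) -> 'I_N -> K).

Definition param_image (T : pred 'I_N) (a : 'I_N -> K) g Phi (y : 'I_N -> K) : Prop :=
  exists x, [/\ slice T a x, g.@[x] != 0 & y = Phi x].

Lemma regular_numerator_eq0 g F A e x :
  (forall x, g.@[x] != 0 -> g.@[x] ^+ e * F x = A.@[x]) ->
  g.@[x] != 0 -> A.@[x] = 0 -> F x = 0.
Proof.
move=> H gx /eqP; rewrite -H // mulf_eq0 expf_eq0 (negbTE gx) andbF.
by move/eqP.
Qed.

(* Pull [p * q] back along [Phi] and clear denominators: the numerators are
   polynomials whose product vanishes on the slice. *)
Lemma vanishing_prime_param_image T a g Phi :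
  regular_map g Phi -> (exists x, slice T a x /\ g.@[x] != 0) ->
  vanishing_prime (param_image T a g Phi).
Proof.
move=> rPhi [x0 [s0 gx0]] p q pq0.
have [Ap [ep Hp]] := regular_comp p rPhi.
have [Aq [eq Hq]] := regular_comp q rPhi.
have num0 : forall x, slice T a x -> g.@[x] * (Ap * Aq).@[x] = 0.
  move=> x sx; have [->|gx] := eqVneq g.@[x] 0; first by rewrite mul0r.
  by rewrite mevalM -Hp // -Hq // mulrACA pq0 ?mulr0 //; exists x.
have [g0|ApAq0] := vanishing_prime_slice K_infinite num0.
  by move: gx0; rewrite g0 ?eqxx.
have [Ap0|Aq0] : (forall x, slice T a x -> Ap.@[x] = 0) \/
                 (forall x, slice T a x -> Aq.@[x] = 0).
  apply: (vanishing_prime_slice K_infinite (T := T) (a := a)) => x sx.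
  by rewrite -mevalM ApAq0.
- by left => _ [x [sx gx ->]]; apply: regular_numerator_eq0 Hp gx (Ap0 x sx).
- by right => _ [x [sx gx ->]]; apply: regular_numerator_eq0 Hq gx (Aq0 x sx).
Qed.

End ParametrizedImage.

Section ZariskiClosure.
Variables (K : fieldType) (L : closedFieldType) (iota : {rmorphism K -> L}) (N : nat).
Implicit Types (S : ('I_N -> K) -> Prop).

Lemma meval_map_mpoly (p : {mpoly K[N]}) (x : 'I_N -> K) :
  (map_mpoly iota p).@[fun i => iota (x i)] = iota p.@[x].
Proof.
rewrite /map_mpoly /mmap raddf_sum mevalE rmorph_sum /=; apply: eq_bigr => mu _.
rewrite mevalM /= mevalC rmorphM /=; congr (_ * _).
rewrite /mmap1 rmorph_prod rmorph_prod /=; apply: eq_bigr => i _.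
by rewrite !rmorphXn /= mevalXU.
Qed.

Definition iota_free s (e : 'I_s -> L) :=
  forall c : 'I_s -> K, \sum_i iota (c i) * e i = 0 -> forall i, c i = 0.

Lemma unlift_max_widen s (i : 'I_s) : unlift ord_max (widen_ord (leqnSn s) i) = Some i.
Proof.
have -> : widen_ord (leqnSn s) i = lift ord_max i.
  by apply: val_inj; rewrite /= /bump leqNgt ltn_ord.
by rewrite liftK.
Qed.

Lemma exists_iota_basis (ls : seq L) :
  exists s (e : 'I_s -> L) (kap : L -> 'I_s -> K),
    iota_free e /\ forall l, l \in ls -> l = \sum_i iota (kap l i) * e i.
Proof.
elim: ls => [|l ls [s [e [kap [free_e span_e]]]]].
  by exists 0%N, (fun _ => 0), (fun _ _ => 0); split => // c _ [].
case: (classic (exists c : 'I_s -> K, l = \sum_i iota (c i) * e i)) => [[c hc]|nspan].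
  exists s, e, (fun x => if x == l then c else kap x); split => // x.
  by rewrite in_cons; case: eqP => [-> _ //|_ /=]; exact: span_e.
pose e' (i : 'I_s.+1) := if unlift ord_max i is Some j then e j else l.
pose kap' (x : L) (i : 'I_s.+1) := if unlift ord_max i is Some j
   then (if x == l then 0 else kap x j) else (if x == l then 1 else 0).
exists s.+1, e', kap'; split.
  move=> c; rewrite big_ord_recr /= /e' unlift_none.
  under eq_bigr => i _ do rewrite unlift_max_widen.
  move=> H; have cmax : c ord_max = 0.
    apply: NNPP => cn; apply: nspan.
    exists (fun i => - c (widen_ord (leqnSn s) i) / c ord_max).
    apply: (mulfI (_ : iota (c ord_max) != 0)); first by rewrite fmorph_eq0; apply/eqP.
    have -> : iota (c ord_max) * l = - \sum_i iota (c (widen_ord (leqnSn s) i)) * e i.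
      by apply/eqP; rewrite -addr_eq0 addrC H.
    rewrite mulr_sumr -sumrN; apply: eq_bigr => i _.
    rewrite !rmorphM rmorphN /= fmorphV /=.
    by field; rewrite fmorph_eq0; apply/eqP.
  move: H; rewrite cmax rmorph0 mul0r addr0 => H i.
  case: (unliftP ord_max i) => [j ->|->] //.
  have -> : lift ord_max j = widen_ord (leqnSn s) j.
    by apply: val_inj; rewrite /= /bump leqNgt ltn_ord.
  exact: (free_e (fun j => c (widen_ord (leqnSn s) j)) H j).
move=> x; rewrite in_cons big_ord_recr /= /kap' /e' unlift_none.
under eq_bigr => i _ do rewrite unlift_max_widen.
case: eqP => [-> _|_ /= xl].
  by rewrite big1 ?add0r ?rmorph1 ?mul1r // => i _; rewrite rmorph0 mul0r.
by rewrite rmorph0 mul0r addr0; apply: span_e.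
Qed.

Lemma mpoly_iota_decomposition (al : {mpoly L[N]}) :
  exists s (e : 'I_s -> L) (bl : 'I_s -> {mpoly K[N]}),
    iota_free e /\ forall z, al.@[z] = \sum_i e i * (map_mpoly iota (bl i)).@[z].
Proof.
have [s [e [kap [free_e span_e]]]] := exists_iota_basis [seq al@_mu | mu <- msupp al].
exists s, e, (fun i => \sum_(mu <- msupp al) kap al@_mu i *: 'X_[mu]); split => // z.
under eq_bigr => i _ do
  rewrite (raddf_sum (map_mpoly iota)) (raddf_sum (meval z)) mulr_sumr.
rewrite exchange_big mevalE /= big_seq [RHS]big_seq; apply: eq_bigr => mu mu_al.
rewrite [X in X * _ = _](span_e al@_mu); last by apply/mapP; exists mu.
rewrite mulr_suml; apply: eq_bigr => i _.
by rewrite map_mpolyZ mevalZ map_mpolyX mevalX; ring.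
Qed.

Lemma zcl_point S x : S x -> zcl iota S (fun i => iota (x i)).
Proof. by move=> Sx p Hp; rewrite meval_map_mpoly Hp // rmorph0. Qed.

Lemma subset_zcl S S' : (forall x, S x -> S' x) -> psubset (zcl iota S) (zcl iota S').
Proof. by move=> SS' z Hz p Hp; apply: Hz => x Sx; apply/Hp/SS'. Qed.

Lemma zclosed_zcl S : zclosed (zcl iota S).
Proof.
exists (fun q => exists p, (forall x, S x -> p.@[x] = 0) /\ q = map_mpoly iota p) => z.
by split=> [Hz q [p [Hp ->]]|H p Hp]; [exact: Hz | apply: H; exists p].
Qed.

(* Expanding an equation of [C] along an [iota]-free basis of its
   coefficients yields equations over [K]. *)
Lemma zcl_not_subset S C : zclosed C -> ~ psubset (zcl iota S) C ->
  exists b : {mpoly K[N]}, ~ (forall x, S x -> b.@[x] = 0) /\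
    forall x, C (fun i => iota (x i)) -> b.@[x] = 0.
Proof.
move=> [PC HC] /not_all_ex_not[z1 nsub]; have [Sz1 /HC nCz1] := imply_to_and _ _ nsub.
have [al nal] := not_all_ex_not _ _ nCz1; have [PCal al_z1] := imply_to_and _ _ nal.
have [s [e [bl [free_e al_bl]]]] := mpoly_iota_decomposition al.
have [i bi] : exists i, ~ (forall x, S x -> (bl i).@[x] = 0).
  apply: NNPP => all0; apply: al_z1; rewrite al_bl big1 // => i _.
  rewrite (Sz1 (bl i)) ?mulr0 // => x Sx.
  by apply: NNPP => bx; apply: all0; exists i => /(_ x Sx).
exists (bl i); split => // x /HC /(_ al PCal); rewrite al_bl.
under eq_bigr => j _ do rewrite meval_map_mpoly mulrC.
by move/free_e.
Qed.

Lemma zirreducible_zcl S :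
  (exists x, S x) -> vanishing_prime S -> zirreducible (zcl iota S).
Proof.
move=> [x0 Sx0] primeS; split; first exact: zclosed_zcl.
split; first by exists (fun i => iota (x0 i)); apply: zcl_point.
move=> A B clA clB cover; apply: NNPP => /not_or_and[nA nB].
have [bA [nbA bA0]] := zcl_not_subset clA nA.
have [bB [nbB bB0]] := zcl_not_subset clB nB.
have prod0 : forall x, S x -> bA.@[x] * bB.@[x] = 0.
  move=> x Sx; case: (cover _ (zcl_point Sx)) => [/bA0|/bB0] ->;
  by rewrite ?mul0r ?mulr0.
by case: (primeS _ _ prod0).
Qed.

End ZariskiClosure.

Section Dimension.
Variables (K : fieldType) (L : closedFieldType) (iota : {rmorphism K -> L}).
Hypothesis K_infinite : forall s : seq K, exists x : K, x \notin s.
Variable N : nat.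

(* Fixing the free coordinates in [drop i s] one at a time gives a strictly
   increasing chain of irreducible closed sets. *)
Lemma zdim_ge_param_image (g : {mpoly K[N]}) (Phi : ('I_N -> K) -> 'I_N -> K)
    (s : seq 'I_N) x0 :
  uniq s -> regular_map g Phi -> (forall j, j \in s -> forall x, Phi x j = x j) ->
  g.@[x0] != 0 -> zdim_ge (zcl iota (param_image pred0 x0 g Phi)) (size s).
Proof.
move=> us rPhi free_s gx0.
pose Z i := zcl iota (param_image (fun j => j \in drop i s) x0 g Phi).
exists Z; split => [i _|i lti].
  split; last by apply: subset_zcl => _ [x [_ gx ->]]; exists x.
  apply: zirreducible_zcl; first by exists (Phi x0), x0.
  by apply: vanishing_prime_param_image => //; exists x0.
split.
  apply: subset_zcl => _ [x [sx gx ->]]; exists x; split => // j jd.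
  by apply: sx; move: jd; rewrite -addn1 addnC -drop_drop; exact: mem_drop.
have [j [rest si]] : exists j rest, drop i s = j :: rest.
  case E: (drop i s) => [|j rest]; last by exists j, rest.
  move: (congr1 size E); rewrite size_drop /= => /eqP.
  by rewrite subn_eq0 leqNgt lti.
have si1 : drop i.+1 s = rest by rewrite -addn1 addnC -drop_drop si /= drop0.
have jr : j \notin rest by have := drop_uniq i us; rewrite si /= => /andP[].
pose x2 k := if k == j then x0 k + 1 else x0 k.
have [t t0 gt] := line_nonvanishing K_infinite x2 [:: 0] gx0.
have yj : line x0 x2 t j = x0 j + t by rewrite /line /x2 eqxx; ring.
have y_slice : slice (fun k => k \in rest) x0 (line x0 x2 t).
  move=> k kr; rewrite /line /x2; case: eqP => [ekj|_].
    by move: jr; rewrite -ekj kr.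
  by rewrite subrr mulr0 addr0.
have js : j \in s by rewrite -(cat_take_drop i s) mem_cat si mem_head orbT.
move=> Zsub; have Zy : Z i (fun k => iota (Phi (line x0 x2 t) k)).
  by apply/Zsub/zcl_point; exists (line x0 x2 t); rewrite si1.
have := Zy ('X_j - (x0 j)%:MP).
rewrite meval_map_mpoly mevalB mevalXU mevalC free_s // yj addrAC subrr add0r.
move: t0; rewrite inE => t0 ht; have : iota t != 0 by rewrite fmorph_eq0.
rewrite ht ?eqxx // => _ [x [sx gx ->]].
by rewrite mevalB mevalXU mevalC free_s // sx ?subrr // si mem_head.
Qed.

End Dimension.

Section Blocks.
Variables (d : nat) (n : 'I_d -> nat).
Local Notation N := (totdim n).

Definition blk (j : 'I_N) : 'I_d := tagnat.sig1 j.

Lemma blk_bidx (k : 'I_d) (i : 'I_(n k)) : blk (bidx i) = k.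
Proof. exact: tagnat.Rank1K. Qed.

Lemma bidx_inj (k : 'I_d) : injective (@bidx d n k).
Proof.
move=> i i' h; have := tagnat.eq_Rank i i'; rewrite /bidx in h.
by rewrite h eqxx => /esym; rewrite eqxx /= => /eqP; exact: val_inj.
Qed.

Lemma big_blk (R : nmodType) (k : 'I_d) (G : 'I_N -> R) :
  \sum_(i < n k) G (bidx i) = \sum_(j | blk j == k) G j.
Proof.
rewrite -(big_imset _ (in2W (@bidx_inj k))) /=.
apply: eq_bigl => j; apply/imsetP/eqP => [[i _ ->]|<-]; first exact: blk_bidx.
by exists (tagnat.sig2 j) => //; rewrite /bidx tagnat.sig2K.
Qed.

Variable K : fieldType.
Implicit Types (f : ('I_N -> K) -> K) (y z : 'I_N -> K).

Definition incr_at z (j : 'I_N) : 'I_N -> K := fun l => if l == j then z l + 1 else z l.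

(* The coefficients of the affine function on block [k] are difference quotients. *)
Lemma multi_affine_expand f (k : 'I_d) z y : multi_affine f ->
  (forall j, blk j != k -> y j = z j) ->
  f y = f z + \sum_(j | blk j == k) (f (incr_at z j) - f z) * (y j - z j).
Proof.
move=> [_ fma] yz; have [a [b ab]] := fma k z.
have affine : forall y', (forall j, blk j != k -> y' j = z j) ->
    f y' = b + \sum_(i < n k) a i * y' (bidx i).
  by move=> y' y'z; apply: ab => j i jk; apply: y'z; rewrite blk_bidx.
have slope : forall i, f (incr_at z (bidx i)) - f z = a i.
  move=> i0; rewrite !affine //; last first.
    move=> j jk; rewrite /incr_at; case: eqP => // ej.
    by move: jk; rewrite ej blk_bidx eqxx.
  rewrite opprD addrACA subrr add0r -sumrB (bigD1 i0) //= big1 ?addr0.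
    by rewrite /incr_at eqxx; ring.
  move=> i ii0; rewrite /incr_at; case: eqP => [/bidx_inj ei|_]; last by rewrite subrr.
  by rewrite ei eqxx in ii0.
rewrite -big_blk; under eq_bigr => i _ do rewrite slope.
by rewrite (affine _ yz) (affine z) // -addrA -big_split /=; congr (_ + _);
   apply: eq_bigr => i _; ring.
Qed.

End Blocks.

Section MaximalMinors.
Variable F : fieldType.

Lemma exists_max_minor m N (M : 'M[F]_(m, N)) :
  exists (R : 'I_(\rank M) -> 'I_m) (J : 'I_(\rank M) -> 'I_N),
    colsub J (rowsub R M) \in unitmx.
Proof.
pose R := maxrankfun M.
have rkT : row_full (rowsub R M)^T.
  by rewrite /row_full mxrank_tr; exact: maxrowsub_free.
exists R, (fullrankfun rkT); rewrite -unitmx_tr.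
suff -> : (colsub (fullrankfun rkT) (rowsub R M))^T =
          rowsub (fullrankfun rkT) (rowsub R M)^T by exact: fullrowsub_unit.
by apply/matrixP => a b; rewrite !mxE.
Qed.

Lemma colsub1_mulmx_notin N r p (J : 'I_r -> 'I_N) (X : 'M[F]_(r, p)) j l :
  j \notin codom J -> (colsub J 1%:M *m X) j l = 0.
Proof.
move=> jJ; rewrite mxE big1 // => i _; rewrite !mxE.
by case: eqP => [ej|_]; [by rewrite ej codom_f in jJ | rewrite mul0r].
Qed.

(* The rows of the minor span all rows of [M], and the vector is built to be
   killed by them. *)
Lemma mulmx_max_minor_kernel m N r (M : 'M[F]_(m, N)) (R : 'I_r -> 'I_m)
    (J : 'I_r -> 'I_N) (u : 'cV[F]_N) :
  (\rank M <= r)%N -> colsub J (rowsub R M) \in unitmx ->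
  M *m (u - colsub J 1%:M *m (invmx (colsub J (rowsub R M)) *m (rowsub R M *m u)))
  = 0.
Proof.
set MR := rowsub R M; set P := colsub J MR => rkM Punit.
have MR_ker : MR *m (u - colsub J 1%:M *m (invmx P *m (MR *m u))) = 0.
  by rewrite mulmxBr !mulmxA mulmx_colsub mulmx1 mulmxV // mul1mx subrr.
have rkMR : (\rank M <= \rank MR)%N.
  apply: leq_trans rkM (leq_trans _ (mxrankM_maxl MR (colsub J 1%:M))).
  by rewrite mulmx_colsub mulmx1 (mxrank_unit Punit).
have [_ /esym] := mxrank_leqif_sup (rowsub_sub R M).
rewrite eqn_leq rkMR mxrankS ?rowsub_sub // => /submxP[X ->].
by rewrite -mulmxA MR_ker mulmx0.
Qed.

End MaximalMinors.

Lemma exists_max_nat (P : nat -> Prop) (b : nat) :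
  (exists k, P k) -> (forall k, P k -> (k <= b)%N) ->
  exists k, P k /\ forall k', P k' -> (k' <= k)%N.
Proof.
elim: b => [|b IH] [k Pk] Pb.
  by exists k; split => // k' /Pb; rewrite leqn0 => /eqP ->.
case: (classic (P b.+1)) => [Pb1|nPb1]; first by exists b.+1; split => // k' /Pb.
apply: IH; first by exists k.
move=> k' Pk'; have := Pb k' Pk'; rewrite leq_eqVlt ltnS => /orP[/eqP ek'|//].
by rewrite ek' in Pk'.
Qed.

Section Construction.
Variable K : fieldType.
Hypothesis K_infinite : forall s : seq K, exists x : K, x \notin s.
Variables (d : nat) (n : 'I_d -> nat) (m : nat).
Local Notation N := (totdim n).
Variable f : 'I_m -> ('I_N -> K) -> K.
Hypothesis f_ma : forall e, multi_affine (f e).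
Variables (c : 'I_m -> K) (v : 'I_N -> K).
Hypothesis fv : forall e, f e v = c e.
Implicit Types (g : {mpoly K[N]}) (Phi Psi : ('I_N -> K) -> 'I_N -> K).
Implicit Types (x y z : 'I_N -> K).

Definition vtail (k : nat) y : 'I_N -> K := fun j => if (k <= blk j)%N then v j else y j.

Definition eq_below (k : nat) x y := forall j, (blk j < k)%N -> x j = y j.

Lemma vtail_eq_below k y y' : eq_below k y y' -> vtail k y = vtail k y'.
Proof.
move=> yy'; apply: functional_extensionality => j.
by rewrite /vtail leqNgt; case: ltnP => // /yy'.
Qed.

Definition slope_mx (k : 'I_d) z : 'M[K]_(m, N) :=
  \matrix_(e, j) (if blk j == k then f e (incr_at z j) - f e z else 0).

Lemma slope_mx_expand e (k : 'I_d) z y (w : 'cV[K]_N) :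
  (forall j, blk j != k -> y j = z j) ->
  (forall j, blk j == k -> y j = z j + w j 0) ->
  f e y = f e z + (slope_mx k z *m w) e 0.
Proof.
move=> yz_out yz_in; rewrite (multi_affine_expand (f_ma e) yz_out); congr (_ + _).
rewrite mxE [RHS](bigID (fun j => blk j == k)) /= [X in _ = _ + X]big1 ?addr0.
  by apply: eq_bigr => j jk; rewrite mxE jk yz_in // addrAC subrr add0r.
by move=> j /negbTE jk; rewrite mxE jk mul0r.
Qed.

Lemma regular_f g e Psi : regular_map g Psi -> regular g (fun x => f e (Psi x)).
Proof.
have [[p fp] _] := f_ma e; move=> rPsi.
by apply: regular_ext (regular_comp p rPsi) _ => x _; rewrite fp.
Qed.

Lemma regular_vtail g k Psi :
  regular_map g Psi -> regular_map g (fun x => vtail k (Psi x)).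
Proof.
by move=> rPsi j; rewrite /vtail; case: leqP => _; [exact: regular_cst | exact: rPsi].
Qed.

Lemma regular_slope_mx g k Psi :
  regular_map g Psi -> regular_mx g (fun x => slope_mx k (Psi x)).
Proof.
move=> rPsi e j; apply: regular_ext (_ : regular g (fun x => if blk j == k
   then f e (incr_at (Psi x) j) - f e (Psi x) else 0)) _; last first.
  by move=> x _; rewrite mxE.
case: (blk j == k); last exact: regular_cst.
apply: regularB; apply: regular_f => // l; rewrite /incr_at; case: (l == j) => //.
by apply: regularD; [exact: rPsi | exact: regular_cst].
Qed.

(* The invariant after the blocks [< k] have been treated: on [g != 0], [Phi]
   changes only the blocks [< k], regularly and depending only on them, so
   that together with the remaining blocks of [v] it solves the system; the
   coordinates in [I] stay free and [v] lies in the closure of the image. *)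
Record partial_param (k : nat) g Phi (I : seq 'I_N) : Prop := {
  pp_solution : forall x, g.@[x] != 0 -> forall e, f e (vtail k (Phi x)) = c e;
  pp_regular : regular_map g Phi;
  pp_head : forall x x', eq_below k x x' ->
    (g.@[x] != 0) = (g.@[x'] != 0) /\ eq_below k (Phi x) (Phi x');
  pp_nonempty : exists x, g.@[x] != 0;
  pp_closure : forall p : {mpoly K[N]},
    (forall x, g.@[x] != 0 -> p.@[Phi x] = 0) -> p.@[v] = 0;
  pp_uniq : uniq I;
  pp_free : forall j, j \in I -> forall x, Phi x j = x j;
  pp_tail_free : forall j, (k <= blk j)%N -> j \in I;
  pp_size : (N <= size I + k * m)%N }.

Lemma partial_param0 : partial_param 0 1 (fun x => x) (enum 'I_N).
Proof.
split.
- by move=> x _ e; rewrite -fv.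
- exact: regular_id.
- by move=> x x' _; rewrite !meval1.
- by exists (fun _ => 0); rewrite meval1 oner_neq0.
- by move=> p; apply; rewrite meval1 oner_neq0.
- exact: enum_uniq.
- by [].
- by move=> j _; rewrite mem_enum.
- by rewrite size_enum_ord mul0n addn0.
Qed.

Section Step.
Variables (k : 'I_d) (g : {mpoly K[N]}) (Phi : ('I_N -> K) -> 'I_N -> K) (I : seq 'I_N).
Hypothesis hk : partial_param k g Phi I.

Definition step_slope x := slope_mx k (vtail k (Phi x)).

Variable x0 : 'I_N -> K.
Hypothesis gx0 : g.@[x0] != 0.
Hypothesis slope_rank_max :
  forall x, g.@[x] != 0 -> (\rank (step_slope x) <= \rank (step_slope x0))%N.
Variables (R : 'I_(\rank (step_slope x0)) -> 'I_m)
          (J : 'I_(\rank (step_slope x0)) -> 'I_N).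

Definition step_minor x := colsub J (rowsub R (step_slope x)).

Hypothesis minor0_unit : step_minor x0 \in unitmx.
Variables (D : {mpoly K[N]}) (eD : nat).
Hypothesis D_det :
  forall x, g.@[x] != 0 -> g.@[x] ^+ eD * \det (step_minor x) = D.@[x].

(* The new block [k] is [v + w], where [w] is the point of the kernel of the
   slope matrix whose coordinates outside [J] are those of [x - v]. *)
Definition step_u x : 'cV[K]_N :=
  \col_j (if (blk j == k) && (j \notin codom J) then x j - v j else 0).

Definition step_w x : 'cV[K]_N :=
  step_u x - colsub J 1%:M *m
    (invmx (step_minor x) *m (rowsub R (step_slope x) *m step_u x)).

Definition step_Phi x j := if blk j == k then v j + step_w x j 0 else Phi x j.

Definition step_I := [seq j <- I | ~~ ((blk j == k) && (j \in codom J))].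

Lemma step_slope_eq_below x x' : eq_below k x x' -> step_slope x = step_slope x'.
Proof.
by move=> /(pp_head hk)[_ /vtail_eq_below Exx']; rewrite /step_slope Exx'.
Qed.

Lemma regular_step_minor : regular_mx g step_minor.
Proof.
move=> a b; have := regular_slope_mx k (regular_vtail k (pp_regular hk)) (R a) (J b).
by move=> rS; apply: regular_ext rS _ => x _; rewrite !mxE.
Qed.

Lemma step_dom x :
  ((g * D).@[x] != 0) = (g.@[x] != 0) && (step_minor x \in unitmx).
Proof.
rewrite mevalM mulf_eq0 negb_or unitmxE unitfE; case gx: (g.@[x] != 0) => //=.
by rewrite -D_det // mulf_eq0 expf_eq0 (negbTE gx) andbF.
Qed.

Lemma step_kernel x : (g * D).@[x] != 0 -> step_slope x *m step_w x = 0.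
Proof.
rewrite step_dom => /andP[gx Px].
by apply: mulmx_max_minor_kernel; [exact: slope_rank_max|].
Qed.

Lemma step_solution x :
  (g * D).@[x] != 0 -> forall e, f e (vtail k.+1 (step_Phi x)) = c e.
Proof.
move=> gDx e; have := gDx; rewrite step_dom => /andP[gx _].
rewrite (@slope_mx_expand e k (vtail k (Phi x)) _ (step_w x)).
- by rewrite -/(step_slope x) step_kernel // mxE addr0 (pp_solution hk).
- move=> j jk; rewrite /vtail /step_Phi (negbTE jk).
  move: jk; rewrite -val_eqE /= => jk.
  by case: leqP => h1; case: leqP => h2 //; exfalso; lia.
- by move=> j /eqP jk; rewrite /vtail /step_Phi jk eqxx leqnn ltnn.
Qed.

Lemma step_regular : regular_map (g * D) step_Phi.
Proof.
have rS : regular_mx (g * D) (fun x => rowsub R (step_slope x)).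
  move=> a b; apply: regular_mulr.
  have := regular_slope_mx k (regular_vtail k (pp_regular hk)) (R a) b.
  by move=> rS; apply: regular_ext rS _ => x _; rewrite !mxE.
have ru : regular_mx (g * D) step_u.
  move=> i j; apply: regular_ext (_ : regular _ (fun x =>
     if (blk i == k) && (i \notin codom J) then x i - v i else 0)) _; last first.
    by move=> x _; rewrite mxE.
  case: ((blk i == k) && (i \notin codom J)); last exact: regular_cst.
  by apply: regularB; [exact: regular_coord | exact: regular_cst].
have rw : regular_mx (g * D) step_w.
  rewrite /step_w; apply: (regular_mxB ru).
  apply: regular_mulmx; first exact: regular_mx_cst.
  exact: regular_mulmx (regular_invmx regular_step_minor D_det) (regular_mulmx rS ru).
move=> j; rewrite /step_Phi; case: (blk j == k).
  by apply: regularD; [exact: regular_cst | exact: rw].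
exact/regular_mulr/(pp_regular hk).
Qed.

Lemma step_head x x' : eq_below k.+1 x x' ->
  ((g * D).@[x] != 0) = ((g * D).@[x'] != 0) /\
  eq_below k.+1 (step_Phi x) (step_Phi x').
Proof.
move=> xx'; have xx'k : eq_below k x x' by move=> j jk; apply: xx'; lia.
have [gxx' Phixx'] := pp_head hk xx'k.
have Sxx' := step_slope_eq_below xx'k.
split; first by rewrite !step_dom gxx' /step_minor Sxx'.
have uxx' : step_u x = step_u x'.
  apply/matrixP => i l; rewrite !mxE; case: ifP => // /andP[/eqP ik _].
  by rewrite xx' // ik.
move=> j jk; rewrite /step_Phi /step_w /step_minor uxx' Sxx'.
case: eqP => // /eqP; rewrite -val_eqE /= => jk'.
by apply: Phixx'; lia.
Qed.

Lemma step_nonempty : exists x, (g * D).@[x] != 0.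
Proof. by exists x0; rewrite step_dom gx0. Qed.

Definition reset_blk y j := if blk j == k then v j else y j.

(* Resetting block [k] of [x] to [v] kills [step_u], hence [step_w]. *)
Lemma step_Phi_reset_blk x : g.@[x] != 0 -> step_minor x \in unitmx ->
  (g * D).@[reset_blk x] != 0 /\ step_Phi (reset_blk x) = reset_blk (Phi x).
Proof.
move=> gx Px; have xhx : eq_below k (reset_blk x) x.
  by move=> j jk; rewrite /reset_blk -val_eqE /= ltn_eqF.
have [gxh Phixh] := pp_head hk xhx.
split; first by rewrite step_dom gxh gx /step_minor (step_slope_eq_below xhx).
have u0 : step_u (reset_blk x) = 0.
  apply/matrixP => i l; rewrite !mxE /reset_blk.
  by case: ifP => // /andP[-> _]; rewrite subrr.
apply: functional_extensionality => j.
rewrite /step_Phi /reset_blk /step_w u0 !mulmx0 subr0 mxE addr0.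
case: ifP => // /negbT; rewrite -val_eqE /= neq_ltn => /orP[jk|kj].
  by apply: Phixh.
have jk : (blk j == k) = false by apply/negbTE; rewrite -val_eqE /= gtn_eqF.
by rewrite !(pp_free hk) ?(pp_tail_free hk) ?jk // ltnW.
Qed.

Lemma step_closure p :
  (forall x, (g * D).@[x] != 0 -> p.@[step_Phi x] = 0) -> p.@[v] = 0.
Proof.
move=> p0.
have [p' p'E] : exists p' : {mpoly K[N]}, forall y, p.@[reset_blk y] = p'.@[y].
  apply: regular1_mpoly; apply: regular_comp => j; rewrite /reset_blk.
  by case: (blk j == k); [exact: regular_cst | exact: regular_coord].
have [Dp DpE] : exists Dp : {mpoly K[N]},
    forall y, \det (colsub J (rowsub R (slope_mx k (vtail k y)))) = Dp.@[y].
  apply: regular1_mpoly; apply: regular_det => a b.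
  have := regular_slope_mx k (regular_vtail k (@regular_id K N 1)) (R a) (J b).
  by move=> rS; apply: regular_ext rS _ => y _; rewrite !mxE.
have minorE x : \det (step_minor x) = Dp.@[Phi x] := DpE (Phi x).
have x0_dom : exists x, slice pred0 x0 x /\ g.@[x] != 0 by exists x0.
have p'Dp0 : forall y, param_image pred0 x0 g Phi y -> p'.@[y] * Dp.@[y] = 0.
  move=> _ [x [_ gx ->]]; rewrite -minorE.
  have [Px|] := boolP (step_minor x \in unitmx); last first.
    by rewrite unitmxE unitfE negbK => /eqP ->; rewrite mulr0.
  have [gDxh Phixh] := step_Phi_reset_blk gx Px.
  by rewrite -p'E -Phixh p0 // mul0r.
have [p'0|Dp0] :=
  vanishing_prime_param_image K_infinite (pp_regular hk) x0_dom p'Dp0.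
  rewrite (@meval_eq _ _ _ (reset_blk v)) => [|j]; last first.
    by rewrite /reset_blk; case: ifP.
  by rewrite p'E; apply: (pp_closure hk) => x gx; apply: p'0; exists x.
move: minor0_unit; rewrite unitmxE unitfE minorE Dp0 ?eqxx //.
by exists x0.
Qed.

Lemma step_free j : j \in step_I -> forall x, step_Phi x j = x j.
Proof.
rewrite mem_filter => /andP[jJ jI] x; rewrite /step_Phi.
case: ifP => jk; last exact: (pp_free hk).
rewrite jk /= in jJ; rewrite /step_w mxE [X in _ + (_ + X)]mxE.
by rewrite colsub1_mulmx_notin // subr0 mxE jk jJ /= addrC subrK.
Qed.

Lemma step_tail_free j : (k.+1 <= blk j)%N -> j \in step_I.
Proof.
move=> kj; rewrite mem_filter (pp_tail_free hk) ?andbT ?(ltnW kj) //.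
by rewrite -val_eqE /= gtn_eqF.
Qed.

Lemma step_size : (N <= size step_I + k.+1 * m)%N.
Proof.
have rk : (\rank (step_slope x0) <= m)%N := rank_leq_row _.
have cnt : (size I <= size step_I + \rank (step_slope x0))%N.
  rewrite size_filter -(count_predC (fun j => ~~ ((blk j == k) && (j \in codom J))) I).
  rewrite leq_add2l -size_filter.
  apply: leq_trans (_ : (size (codom J) <= _)%N); last by rewrite size_codom card_ord.
  apply: uniq_leq_size; first exact: filter_uniq (pp_uniq hk).
  by move=> j; rewrite mem_filter /= negbK => /andP[/andP[_ jJ] _].
have := pp_size hk; rewrite mulSn; lia.
Qed.

Lemma step_partial_param : partial_param k.+1 (g * D) step_Phi step_I.
Proof.
split.
- exact: step_solution.
- exact: step_regular.
- exact: step_head.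
- exact: step_nonempty.
- exact: step_closure.
- exact/filter_uniq/(pp_uniq hk).
- exact: step_free.
- exact: step_tail_free.
- exact: step_size.
Qed.

End Step.

Lemma partial_param_succ (k : 'I_d) g Phi I :
  partial_param k g Phi I -> exists g' Phi' I', partial_param k.+1 g' Phi' I'.
Proof.
move=> hk; have [x1 gx1] := pp_nonempty hk.
pose has_rank r := exists x, g.@[x] != 0 /\ \rank (step_slope k Phi x) = r.
have [r [[x0 [gx0 rx0]] rmax]] :
    exists r, has_rank r /\ forall r', has_rank r' -> (r' <= r)%N.
  apply: (@exists_max_nat _ m); first by exists (\rank (step_slope k Phi x1)), x1.
  by move=> _ [x [_ <-]]; exact: rank_leq_row.
have slope_rank_max x :
    g.@[x] != 0 -> (\rank (step_slope k Phi x) <= \rank (step_slope k Phi x0))%N.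
  by move=> gx; rewrite rx0; apply: rmax; exists x.
have [R [J minor0_unit]] := exists_max_minor (step_slope k Phi x0).
have [D [eD D_det]] := regular_det (regular_step_minor hk R J).
do 3!eexists.
exact: (step_partial_param hk gx0 slope_rank_max (R := R) (J := J) minor0_unit D_det).
Qed.

Lemma partial_param_exists : exists g Phi I, partial_param d g Phi I.
Proof.
suff : forall k, (k <= d)%N -> exists g Phi I, partial_param k g Phi I by apply.
elim=> [_|k IH kd]; first by exists 1, (fun x => x), (enum 'I_N); exact: partial_param0.
have [g [Phi [I hk]]] := IH (ltnW kd).
exact: (@partial_param_succ (Ordinal kd) _ _ _ hk).
Qed.

End Construction.

Theorem theorem1p2 (K : fieldType)
  (K_infinite : forall s : seq K, exists x : K, x \notin s)
  (L : closedFieldType) (iota : {rmorphism K -> L})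
  (L_alg : is_alg_closure iota)
  (d : nat) (n : 'I_d -> nat) (m : nat)
  (f : 'I_m -> ('I_(totdim n) -> K) -> K)
  (f_ma : forall k, multi_affine (f k))
  (c : 'I_m -> K) (v : 'I_(totdim n) -> K)
  (hv : forall k, f k v = c k) :
  let Z := fun w : 'I_(totdim n) -> K => forall k, f k w = c k in
  exists W : ('I_(totdim n) -> K) -> Prop,
    psubset W Z /\
    zcl iota W (fun i => iota (v i)) /\
    zirreducible (zcl iota W) /\
    zcodim_le (zcl iota W) (2 ^ d * m)%N.
Proof.
move=> Z; have [g [Phi [I hd]]] := partial_param_exists K_infinite f_ma hv.
have [x0 gx0] := pp_nonempty hd.
have x0_dom : exists x, slice pred0 x0 x /\ g.@[x] != 0 by exists x0.
exists (param_image pred0 x0 g Phi); split.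
  move=> _ [x [_ gx ->]] e; rewrite -(pp_solution hd gx e); congr (f e _).
  by apply: functional_extensionality => j; rewrite /vtail leqNgt ltn_ord.
split.
  move=> p p0; rewrite meval_map_mpoly (pp_closure hd) ?rmorph0 // => x gx.
  by apply: p0; exists x.
split.
  apply: zirreducible_zcl; first by exists (Phi x0), x0.
  exact: (vanishing_prime_param_image K_infinite (pp_regular hd) x0_dom).
exists (size I); split.
  exact: (zdim_ge_param_image iota K_infinite
           (pp_uniq hd) (pp_regular hd) (pp_free hd) gx0).
apply: leq_trans (pp_size hd) _; rewrite leq_add2l leq_mul2r.
by rewrite ltnW ?orbT // ltn_expl.
Qed.
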